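(* Suppose that $U\subseteq\{0,1\}^3$ is a Boolean relation of arity $3$ that is not balanced. Then the $2$-OR relation is cone-definable from $U$.
   Context: A partial Boolean operation $f$ of arity $\ell$ is balanced if there are integers $\alpha_1,\ldots,\alpha_\ell$ with $\sum\alpha_i=1$ such that its domain is exactly the tuples with $\sum\alpha_ix_i\in\{0,1\}$, on which $f(x)=\sum\alpha_ix_i$. $f$ preserves $T\subseteq\{0,1\}^m$ if for all $t^1,\ldots,t^\ell\in T$, whenever the coordinatewise application of $f$ is defined in every coordinate, the result lies in $T$; a relation is balanced if preserved by all balanced operations. The $2$-OR relation is $\{(0,1),(1,0),(1,1)\}$. A relation $T$ of arity $m$ is cone-definable from a relation $U$ of arity $n$ if there is a tuple $(y_1,\ldots,y_n)$ with each $y_j\in\{0,1\}\cup\{x_1,\ldots,x_m\}\cup\{\neg x_1,\ldots,\neg x_m\}$, every $x_i$ occurs (as $x_i$ or $\neg x_i$) among the $y_j$, and for each $f\colon\{x_1,\ldots,x_m\}\to\{0,1\}$: $(f(x_1),\ldots,f(x_m))\in T$ iff $(\hat f(y_1),\ldots,\hat f(y_n))\in U$, where $\hat f(0)=0$, $\hat f(1)=1$, $\hat f(x_i)=f(x_i)$, $\hat f(\neg x_i)=\neg f(x_i)$. *)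

(* Defs.v *)
From mathcomp Require Import all_boot all_order all_algebra.

Set Implicit Arguments.
Unset Strict Implicit.
Unset Printing Implicit Defensive.

Import GRing.Theory.
Local Open Scope ring_scope.

Notation bool_relation m := {set m.-tuple bool}.

(* [None] means "undefined". *)
Definition partial_op (l : nat) := l.-tuple bool -> option bool.

Definition int_of_bool (b : bool) : int := (nat_of_bool b)%:Z.

Definition int_comb (l : nat) (alpha : 'I_l -> int) (x : l.-tuple bool) : int :=
  \sum_(i < l) alpha i * int_of_bool (tnth x i).

Definition balanced_op (l : nat) (f : partial_op l) : Prop :=
  exists alpha : 'I_l -> int,
    [/\ \sum_(i < l) alpha i = 1,
        forall x : l.-tuple bool,
          (f x <> None) <-> (int_comb alpha x = 0 \/ int_comb alpha x = 1)
      & forall (x : l.-tuple bool) (b : bool),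
          f x = Some b -> int_of_bool b = int_comb alpha x].

(* [f] defined in every coordinate is expressed by the existence of a tuple [r]
   of its values. *)
Definition preserves (l m : nat) (f : partial_op l) (T : bool_relation m) : Prop :=
  forall t : 'I_l -> m.-tuple bool,
    (forall i, t i \in T) ->
    forall r : m.-tuple bool,
      (forall j : 'I_m, f [tuple tnth (t i) j | i < l] = Some (tnth r j)) ->
      r \in T.

Definition balanced_rel (m : nat) (T : bool_relation m) : Prop :=
  forall (l : nat) (f : partial_op l), balanced_op f -> preserves f T.

Definition two_OR : bool_relation 2 :=
  [set [tuple false; true]; [tuple true; false]; [tuple true; true]].

Inductive cone_entry (m : nat) : Type :=
  | CConst of bool
  | CVar of 'I_m
  | CNeg of 'I_m.

Arguments CConst {m} _.

Definition cone_eval (m : nat) (f : 'I_m -> bool) (y : cone_entry m) : bool :=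
  match y with
  | CConst b => b
  | CVar i => f i
  | CNeg i => ~~ f i
  end.

Definition cone_definable (m n : nat) (T : bool_relation m) (U : bool_relation n) : Prop :=
  exists y : n.-tuple (cone_entry m),
    (forall i : 'I_m, exists j : 'I_n, tnth y j = CVar i \/ tnth y j = CNeg i) /\
    (forall f : 'I_m -> bool,
       [tuple f i | i < m] \in T <->
       [tuple cone_eval f (tnth y j) | j < n] \in U).

(* Main.v *)
Require Import Defs.
From mathcomp Require Import all_boot all_order all_algebra.

(** If [U] contains three corners [a], [b], [c] of a parallelogram whose fourth
corner [d = a - b + c] is a Boolean tuple outside [U], then
[d + x_1 (a - d) + x_2 (c - d)] is a cone definition of 2-OR, in any arity.
Otherwise [U] is closed under completing parallelograms, and in arity 3 this
makes every tuple outside [U] violate some affine congruence modulo 4 that holds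
on [U]. Such congruences are inherited by integer affine combinations, so [U] is
balanced. *)

Set Implicit Arguments.
Unset Strict Implicit.
Unset Printing Implicit Defensive.

Import GRing.Theory.
Local Open Scope ring_scope.

(* On bits, [a - b + c = d] iff [a = b, c = d] or [a = d, b = c]. *)
Definition bit_parallelogram (a b c d : bool) : bool :=
  (a == b) && (c == d) || (a == d) && (b == c).

Definition parallelogram (m : nat) (a b c d : m.-tuple bool) : bool :=
  [forall j, bit_parallelogram (tnth a j) (tnth b j) (tnth c j) (tnth d j)].

(** Being Boolean-valued, its failure constructively yields the four corners. *)
Definition parallelogram_closed (m : nat) (U : bool_relation m) : bool :=
  [forall a in U, forall b in U, forall c in U, forall d,
     parallelogram a b c d ==> (d \in U)].

Lemma tuple_neq_ex (m : nat) (a b : m.-tuple bool) :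
  a != b -> exists j, tnth a j != tnth b j.
Proof.
move=> neq_ab; apply/existsP; apply: contraR neq_ab => /existsPn eq_ab.
by apply/eqP/eq_from_tnth => j; apply/eqP; rewrite -[_ == _]negbK eq_ab.
Qed.

Lemma in_two_OR (f : 'I_2 -> bool) :
  ([tuple f i | i < 2] \in two_OR) = f ord0 || f ord_max.
Proof.
have -> : [tuple f i | i < 2] = [tuple f ord0; f ord_max].
  by apply: eq_from_tnth => -[[|[|//]] lti];
    rewrite tnth_mktuple /tnth /=; congr f; apply: val_inj.
by rewrite !inE; case: (f ord0); case: (f ord_max).
Qed.

(** In each coordinate of a parallelogram at most one of [a], [c] differs from [d], so
    [d + x_1 (a - d) + x_2 (c - d)] is a constant or a single literal there, negated exactly when
    [d] is 1. *)
Definition parallelogram_entry (a c d : bool) : cone_entry 2 :=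
  if a != d then if d then CNeg ord0 else CVar ord0
  else if c != d then if d then CNeg ord_max else CVar ord_max
  else CConst d.

Lemma two_OR_cone_definable (m : nat) (U : bool_relation m) :
  ~~ parallelogram_closed U -> cone_definable two_OR U.
Proof.
case/forall_inPn=> a aU /forall_inPn[b bU] /forall_inPn[c cU] /forallPn[d].
rewrite negb_imply => /andP[/forallP abcd dNU].
(* Since [d] lies outside [U] but [a] and [c] lie inside, each differs from [d] somewhere; those
   coordinates make both variables occur. *)
have [ja ad] : exists j, tnth a j != tnth d j.
  by apply: tuple_neq_ex; apply: contraNneq dNU => <-.
have [jc cd] : exists j, tnth c j != tnth d j.
  by apply: tuple_neq_ex; apply: contraNneq dNU => <-.
exists [tuple parallelogram_entry (tnth a j) (tnth c j) (tnth d j) | j < m].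
split=> [i|f].
  have [-> | ->] : i = ord0 \/ i = ord_max.
  - by case: i => -[|[|//]] lti; [left | right]; apply: val_inj.
  - exists ja; rewrite tnth_mktuple /parallelogram_entry ad.
    by case: (tnth d ja); [right | left].
  exists jc; rewrite tnth_mktuple /parallelogram_entry cd.
  have -> : tnth a jc = tnth d jc.
    move: (abcd jc) cd; rewrite /bit_parallelogram.
    by do 4 case: (tnth _ jc).
  by rewrite eqxx; case: (tnth d jc); [right | left].
rewrite in_two_OR; set v := [tuple _ | j < m].
(* The four assignments produce the four corners, with [b = a + c - d] at (1,1); only [d], at (0,0),
   is outside [U]. *)
have -> : v = if f ord0 then if f ord_max then b else a
              else if f ord_max then c else d.
  apply: eq_from_tnth => j; rewrite /v !tnth_mktuple.
  move: (abcd j); rewrite /bit_parallelogram /parallelogram_entry.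
  case f0: (f ord0); case f1: (f ord_max);
    by case: (tnth a j); case: (tnth b j); case: (tnth c j); case: (tnth d j) => //=;
       rewrite ?f0 ?f1.
by case: (f ord0); case: (f ord_max); rewrite ?aU ?bU ?cU // (negbTE dNU).
Qed.

Definition affine_form (m : nat) (c : 'I_m -> int) (e : int) (x : m.-tuple bool) : int :=
  \sum_(j < m) c j * int_of_bool (tnth x j) + e.

(** The weights sum to 1, so the constant term [e] is reproduced exactly. *)
Lemma affine_form_comb (m l : nat) (c : 'I_m -> int) (e : int)
    (alpha : 'I_l -> int) (t : 'I_l -> m.-tuple bool) (r : m.-tuple bool) :
  \sum_(i < l) alpha i = 1 ->
  (forall j, int_of_bool (tnth r j) =
             \sum_(i < l) alpha i * int_of_bool (tnth (t i) j)) ->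
  affine_form c e r = \sum_(i < l) alpha i * affine_form c e (t i).
Proof.
move=> alpha1 rE; rewrite /affine_form.
under [RHS]eq_bigr do rewrite mulrDr.
rewrite big_split /= -mulr_suml alpha1 mul1r; congr (_ + e).
under [RHS]eq_bigr do rewrite mulr_sumr.
rewrite exchange_big /=; apply: eq_bigr => j _.
by rewrite rE mulr_sumr; apply: eq_bigr => i _; rewrite mulrCA.
Qed.

Lemma balanced_of_congruences (m : nat) (q : int) (U : bool_relation m) :
  (forall r, r \notin U -> exists c e,
     (forall t, t \in U -> (q %| affine_form c e t)%Z) /\
     ~~ (q %| affine_form c e r)%Z) ->
  balanced_rel U.
Proof.
move=> sepU l f [alpha [alpha1 _ fE]] t tU r fr.
apply: contraT => /sepU[c [e [ceU /negP[]]]].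
rewrite (affine_form_comb c e alpha1 (t := t)) => [|j].
  by apply: rpred_sum => i _; apply: dvdz_mull; apply: ceU.
by rewrite (fE _ _ (fr j)); apply: eq_bigr => i _; rewrite tnth_mktuple.
Qed.

Definition bits : seq bool := [:: false; true].
Definition cube : seq (bool * bool * bool) :=
  [seq (xy, z) | xy <- [seq (x, y) | x <- bits, y <- bits], z <- bits].

(** The index of each bit is read in binary with [x0] as leading digit. Eight explicit bits turn a
    quantification over all ternary relations into 256 computable cases. *)
Definition table (b0 b1 b2 b3 b4 b5 b6 b7 : bool) (x : bool * bool * bool) : bool :=
  let: (x0, x1, x2) := x in
  if x0 then if x1 then if x2 then b7 else b6 else if x2 then b5 else b4
  else if x1 then if x2 then b3 else b2 else if x2 then b1 else b0.

Definition parallelogram3 (a b c d : bool * bool * bool) : bool :=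
  [&& bit_parallelogram a.1.1 b.1.1 c.1.1 d.1.1,
      bit_parallelogram a.1.2 b.1.2 c.1.2 d.1.2
    & bit_parallelogram a.2 b.2 c.2 d.2].

Definition cube_closed (p : pred (bool * bool * bool)) : bool :=
  let s := filter p cube in
  all (fun a => all (fun b => all (fun c => all (fun d =>
    parallelogram3 a b c d ==> p d) cube) s) s) s.

Definition congruence4 (c : nat * nat * nat * nat) (x : bool * bool * bool) : bool :=
  (4 %| c.1.1.1 * x.1.1 + c.1.1.2 * x.1.2 + c.1.2 * x.2 + c.2)%N.

Definition cube_separated (p : pred (bool * bool * bool)) : bool :=
  let z4 := iota 0 4 in
  let coefs := [seq (c, e) | c <- [seq (c, c2) | c <- [seq (c0, c1) | c0 <- z4, c1 <- z4],
                                                 c2 <- z4], e <- z4] in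
  let valid := [seq c <- coefs | all (congruence4 c) (filter p cube)] in
  all (fun r => p r || has (fun c => ~~ congruence4 c r) valid) cube.

(** Checked by exhaustion. Neither 2 nor 3 could replace the modulus 4: every affine parity valid on
    {001, 010, 100} holds at 111, and only the zero form modulo 3 vanishes on {000, 011, 101, 110}.
    Modulo 4, parities survive with coefficients doubled. *)
Lemma closed_cube_separated (b0 b1 b2 b3 b4 b5 b6 b7 : bool) :
  let p := table b0 b1 b2 b3 b4 b5 b6 b7 in cube_closed p ==> cube_separated p.
Proof.
by case: b0; case: b1; case: b2; case: b3; case: b4; case: b5; case: b6; case: b7;
   vm_compute.
Qed.

Lemma mem_cube x : x \in cube.
Proof. by case: x => -[[] []] []. Qed.

Definition triple (x : 3.-tuple bool) : bool * bool * bool :=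
  (tnth x ord0, tnth x (lift ord0 ord0), tnth x ord_max).

Definition point (x : bool * bool * bool) : 3.-tuple bool := [tuple x.1.1; x.1.2; x.2].

Lemma tripleK : cancel triple point.
Proof.
by move=> x; apply: eq_from_tnth => -[[|[|[|//]]] lti];
   rewrite [LHS]/tnth /=; congr tnth; apply: val_inj.
Qed.

Lemma point_parallelogram a b c d :
  parallelogram3 a b c d -> parallelogram (point a) (point b) (point c) (point d).
Proof.
by case/and3P=> p0 p1 p2; apply/forallP => -[[|[|[|//]]] lti].
Qed.

(** The coefficients are natural numbers, so the integer form is an embedded natural and both
    divisibility tests compute alike. *)
Lemma affine_form_congruence4 (c : nat * nat * nat * nat) (x : bool * bool * bool) :
  (4 %| affine_form (fun j => (tnth [tuple c.1.1.1; c.1.1.2; c.1.2] j)%:Z) c.2%:Z (point x))%Z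
  = congruence4 c x.
Proof.
by rewrite /affine_form !big_ord_recl big_ord0 addr0 addrA.
Qed.

Lemma closed_balanced3 (U : bool_relation 3) : parallelogram_closed U -> balanced_rel U.
Proof.
move=> closedU; pose u x0 x1 x2 := point (x0, x1, x2) \in U.
(* Tabulating membership in [U] brings it into the form covered by the exhaustive check. *)
pose p := table (u false false false) (u false false true) (u false true false)
  (u false true true) (u true false false) (u true false true) (u true true false)
  (u true true true).
have pE x : p x = (point x \in U) by case: x => -[[] []] [].
have closed_p : cube_closed p.
  apply/allP => a; rewrite mem_filter pE => /andP[aU _].
  apply/allP => b; rewrite mem_filter pE => /andP[bU _].
  apply/allP => c; rewrite mem_filter pE => /andP[cU _].
  apply/allP => d _; apply/implyP => /point_parallelogram abcd; rewrite pE.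
  by move/forall_inP/(_ _ aU)/forall_inP/(_ _ bU)/forall_inP/(_ _ cU)
    /forallP/(_ (point d))/implyP: closedU; apply.
have /allP sep : cube_separated p := implyP (closed_cube_separated _ _ _ _ _ _ _ _) closed_p.
apply: (@balanced_of_congruences _ 4) => r rNU.
have := sep _ (mem_cube (triple r)); rewrite pE tripleK (negbTE rNU) orFb.
case/hasP=> c; rewrite mem_filter => /andP[/allP cU _] cr.
exists (fun j => (tnth [tuple c.1.1.1; c.1.1.2; c.1.2] j)%:Z), c.2%:Z.
split=> [t tU|]; last by rewrite -(tripleK r) affine_form_congruence4.
rewrite -(tripleK t) affine_form_congruence4; apply: cU.
by rewrite mem_filter pE tripleK tU mem_cube.
Qed.

Theorem theorem6p3 (U : bool_relation 3) :
  ~ balanced_rel U -> cone_definable two_OR U.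
Proof.
move=> unbalU; apply: two_OR_cone_definable.
by apply/negP => /closed_balanced3.
Qed.
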